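(* Let $A,B,C$ be positive real constants and consider the $ABC$-flow $$\frac{dx_1}{dz}=A\sin x_3+C\cos x_2,\quad \frac{dx_2}{dz}=B\sin x_1+A\cos x_3,\quad \frac{dx_3}{dz}=C\sin x_2+B\cos x_1$$ on the torus $\mathbb T^3=\{(x_1,x_2,x_3): x_i \bmod 2\pi\}$. For $(\alpha,\beta)\in[0,2\pi]^2$ let $\Gamma_{\alpha,\beta}$ be the solution with initial conditions $x_1(0)=0$, $x_2(0)=\alpha$, $x_3(0)=\beta$. Then the Poincaré section $\Pi=\{(x_1,x_2,x_3)\in\mathbb T^3 : x_1=0 \bmod 2\pi\}$ contains a positive measure set of initial conditions $(\alpha,\beta)$ for which the solution $\Gamma_{\alpha,\beta}$ returns to $\Pi$.
   Context: Points of $\Pi$ are parametrized by $(\alpha,\beta)=(x_2,x_3)\in[0,2\pi]^2$, and ''positive measure'' refers to two-dimensional Lebesgue measure in $(\alpha,\beta)$. The vector field is bounded, so all real solutions are defined for all real time $z$. ''$\Gamma_{\alpha,\beta}$ returns to $\Pi$'' means that there exists a time $\tau>0$ such that $x_1(\tau)=0 \bmod 2\pi$ along $\Gamma_{\alpha,\beta}$. *)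

(* Defs.v *)
From HB Require Import structures.
From mathcomp Require Import all_boot all_order all_algebra.
From mathcomp Require Import all_classical all_reals all_analysis.
Set Implicit Arguments.
Unset Strict Implicit.
Unset Printing Implicit Defensive.
Import Order.TTheory GRing.Theory Num.Theory.
Import numFieldNormedType.Exports.
Local Open Scope classical_set_scope.
Local Open Scope ring_scope.

(* Curves on the torus R^3 / (2 pi Z)^3 are represented by their lifts to R^3
   (the ABC vector field is 2 pi-periodic in each variable), and a point
   (x1, x2, x3) by the nested pair ((x1, x2), x3). *)

Definition abc_solution (R : realType) (A B C : R) (x : R -> R * R * R) : Prop :=
  let x1 := fun z => (x z).1.1 in
  let x2 := fun z => (x z).1.2 in
  let x3 := fun z => (x z).2 in
  forall z : R,
    [/\ is_derive z 1 x1 (A * sin (x3 z) + C * cos (x2 z)),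
        is_derive z 1 x2 (B * sin (x1 z) + A * cos (x3 z))
      & is_derive z 1 x3 (C * sin (x2 z) + B * cos (x1 z))].

(* The lift to R^3 of the section x1 = 0 mod 2 pi. *)
Definition poincare_section (R : realType) : set (R * R * R) :=
  [set x | exists k : int, x.1.1 = k%:~R * (2 * pi)].

Definition returns_to_section (R : realType) (x : R -> R * R * R) : Prop :=
  exists tau : R, 0 < tau /\ poincare_section (x tau).

Definition lebesgue_measure2 (R : realType) :
    set (measurableTypeR R * measurableTypeR R) -> \bar R :=
  (@lebesgue_measure R \x @lebesgue_measure R)%E.

(* Main.v *)
(* Along a solution the [A * C] terms of the second derivative of [x1] cancel,
   leaving x1'' = B (A cos x3 cos x1 - C sin x2 sin x1), which equals A B > 0 at
   (0, pi/2, 0), where x1' = 0: the flow is tangent to the section there, with a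
   fold. Starting on the section near this point with x1' slightly negative, x1
   first decreases and is then brought back through 0 by convexity, within a
   time so short that the bounded speed keeps x1'' >= A B / 2. *)
Require Import Defs.
From HB Require Import structures.
From mathcomp Require Import all_boot all_order all_algebra.
From mathcomp Require Import all_classical all_reals all_analysis.
From mathcomp Require Import ring lra.
Set Implicit Arguments.
Unset Strict Implicit.
Unset Printing Implicit Defensive.
Import Order.TTheory GRing.Theory Num.Theory.
Import numFieldNormedType.Exports.
Local Open Scope classical_set_scope.
Local Open Scope ring_scope.

Section RealFunctions.
Variable R : realType.
Implicit Types (f df : R -> R) (a b m x : R).

Lemma is_derive_continuous f df :
  (forall x, is_derive x 1 f (df x)) -> continuous f.
Proof. by move=> fdf x; exact/differentiable_continuous/derivable1_diffP. Qed.

Lemma ler_derive_increment f df a b m : a <= b ->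
  (forall x, is_derive x 1 f (df x)) -> (forall x, a <= x <= b -> m <= df x) ->
  m * (b - a) <= f b - f a.
Proof.
move=> ab fdf mdf.
have fc : {within `[a, b], continuous f}.
  exact/continuous_subspaceT/(is_derive_continuous fdf).
have [c cab ->] := MVT_segment ab (fun x _ => fdf x) fc.
by rewrite ler_wpM2r ?subr_ge0// mdf.
Qed.

Lemma ler_norm_derive_increment f df a b m : a <= b ->
  (forall x, is_derive x 1 f (df x)) -> (forall x, `|df x| <= m) ->
  `|f b - f a| <= m * (b - a).
Proof.
move=> ab fdf mdf.
have fc : {within `[a, b], continuous f}.
  exact/continuous_subspaceT/(is_derive_continuous fdf).
have [c cab ->] := MVT_segment ab (fun x _ => fdf x) fc.
by rewrite normrM (ger0_norm (_ : 0 <= b - a)) ?subr_ge0// ler_wpM2r ?subr_ge0.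
Qed.

Lemma ler_norm_sin x : `|sin x| <= `|x|.
Proof.
wlog x0 : x / 0 <= x => [h|].
  by have [/h//|/ltW] := leP 0 x; rewrite -oppr_ge0 => /h; rewrite sinN !normrN.
have := ler_norm_derive_increment x0 (@is_derive_sin R) (@cos_max R).
by rewrite sin0 !subr0 mul1r (ger0_norm x0).
Qed.

Lemma cos_ge1B_norm x : 1 - `|x| <= cos x.
Proof.
wlog x0 : x / 0 <= x => [h|].
  by have [/h//|/ltW] := leP 0 x; rewrite -oppr_ge0 => /h; rewrite cosN normrN.
have dcos_le1 y : `|- sin y| <= 1 :> R by rewrite normrN sin_max.
have := ler_norm_derive_increment x0 (@is_derive_cos R) dcos_le1.
by rewrite cos0 !subr0 mul1r (ger0_norm x0) => /ler_normlP[]; lra.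
Qed.

(** The negative initial slope pushes [f] below 0 at once, while the convexity bound gives
    [f T >= T * (f1 0 + m * T / 2) >= 0]. The intermediate value theorem then yields a root after
    the dip. *)
Lemma convex_dip_root (f f1 f2 : R -> R) (m T : R) :
  (forall z : R, is_derive z 1 f (f1 z)) ->
  (forall z : R, is_derive z 1 f1 (f2 z)) ->
  (forall z, 0 <= z <= T -> m <= f2 z) -> 0 < T ->
  f 0 = 0 -> - (m * T / 2) <= f1 0 < 0 ->
  exists2 tau, 0 < tau & f tau = 0.
Proof.
move=> ff1 f1f2 mf2 T0 f0 /andP[f1lo f1neg].
have fT : 0 <= f T.
  (* Subtracting the quadratic Taylor minorant leaves a function that is nondecreasing on
     [[0, T]]. *)
  pose g z := f z - (f1 0 * z + m / 2 * z ^+ 2).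
  pose dg z := f1 z - (f1 0 + m * z).
  have gdg (z : R) : is_derive z 1 g (dg z).
    by rewrite /g /dg; apply: is_derive_eq; rewrite /GRing.scale/=; field.
  have := @ler_derive_increment g dg 0 T 0 (ltW T0) gdg.
  rewrite /g f0 mul0r expr0n/= => h.
  have /h : forall x, 0 <= x <= T -> 0 <= dg x.
    move=> x /andP[x0 xT].
    have := @ler_derive_increment f1 f2 0 x m x0 f1f2 _.
    have h2 z : 0 <= z <= x -> m <= f2 z.
      by move=> /andP[z0 zx]; rewrite mf2// z0 (le_trans zx).
    by move=> /(_ h2); rewrite subr0 /dg; lra.
  have : 0 <= (f1 0 + m * T / 2) * T by rewrite mulr_ge0 ?(ltW T0)//; lra.
  by nra.
(* By continuity [f1] stays negative near 0, so the mean value theorem makes [f] negative there.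
   Searching for the root from [s] on excludes the trivial root 0. *)
have [s /andP[s0 sT] fs] : exists2 s, 0 < s < T & f s < 0.
  have /cvgr_lt/(_ _ f1neg) := @is_derive_continuous f1 f2 f1f2 0.
  move=> /nbhs_ballP[e /= e0 he].
  pose s := Num.min (e / 2) (T / 2).
  have s0 : 0 < s by rewrite lt_min; apply/andP; split; lra.
  have se : s <= e / 2 by rewrite ge_min lexx.
  have sT : s <= T / 2 by rewrite ge_min lexx orbT.
  exists s; first by rewrite s0/=; lra.
  have fc : {within `[0, s], continuous f}.
    exact/continuous_subspaceT/(is_derive_continuous ff1).
  have [c] := MVT s0 (fun x _ => ff1 x) fc.
  rewrite in_itv/= f0 !subr0 => /andP[c0 cs] ->.
  rewrite pmulr_llt0//; apply: he.
  by rewrite /ball/= sub0r normrN gtr0_norm//; lra.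
have [||c] := @IVT R f s T 0 (ltW sT) _ _.
- exact/continuous_subspaceT/(is_derive_continuous ff1).
- by rewrite ge_min (ltW fs)/= le_max fT orbT.
- rewrite in_itv/= => /andP[sc _] fc; exists c => //; exact: lt_le_trans sc.
Qed.

End RealFunctions.

Lemma abc_second_derivative (R : realType) (A B C : R) (x : R -> R * R * R) :
  abc_solution A B C x -> forall z : R,
  is_derive z 1 (fun t => A * sin (x t).2 + C * cos (x t).1.2)
    (B * (A * cos (x z).2 * cos (x z).1.1 - C * sin (x z).1.2 * sin (x z).1.1)).
Proof.
move=> xsol z; have [_ d2 d3] := xsol z.
have ds := is_derive1_comp (is_derive_sin (x z).2) d3.
have dc := is_derive1_comp (is_derive_cos (x z).1.2) d2.
have := is_deriveD (is_deriveZ A ds) (is_deriveZ C dc).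
set d := (X in is_derive _ _ _ X); set e := (X in _ -> is_derive _ _ _ X).
suff -> : d = e by [].
by rewrite /d /e /GRing.scale/=; ring.
Qed.

(** The bound on [T] keeps [x1] and [x3] within [r] of 0 up to time [T]. The bracket in x1'' is then
    at least [A * (1 - 2 * r) - C * r], which the condition on [(2 * A + C) * r] makes at least
    [A / 2]. The last hypothesis is the slope condition of [convex_dip_root] with
    [m = A * B / 2]. *)
Lemma abc_fold_returns (R : realType) (A B C r T alpha beta : R)
    (x : R -> R * R * R) :
  0 < A -> 0 < B -> 0 < C -> 0 < T ->
  r <= 1 / 4 -> (2 * A + C) * r <= A / 2 -> (A + B + C) * T <= r / 2 ->
  abc_solution A B C x -> x 0 = (0, alpha, beta) -> 0 <= beta <= r / 2 ->
  - (A * B / 2 * T / 2) <= A * sin beta + C * cos alpha < 0 ->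
  returns_to_section x.
Proof.
move=> A0 B0 C0 T0 r4 rA Tr xsol x0 betar v0.
pose f2 z :=
  B * (A * cos (x z).2 * cos (x z).1.1 - C * sin (x z).1.2 * sin (x z).1.1).
have d1 (z : R) : is_derive z 1 (fun t => (x t).1.1)
    (A * sin (x z).2 + C * cos (x z).1.2).
  by have [] := xsol z.
have d3 (z : R) : is_derive z 1 (fun t => (x t).2)
    (C * sin (x z).1.2 + B * cos (x z).1.1).
  by have [] := xsol z.
have speed (a b u v : R) : 0 < a -> 0 < b -> `|a * sin u + b * cos v| <= a + b.
  move=> a0 b0; have /ler_normlP[su su'] := sin_max u.
  have /ler_normlP[cv cv'] := cos_max v.
  by apply/ler_normlP; split; nra.
have f2ge (z : R) : 0 <= z <= T -> A * B / 2 <= f2 z.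
  move=> /andP[z0 zT].
  have := ler_norm_derive_increment z0 d1 (fun y => speed _ _ _ _ A0 C0).
  have := ler_norm_derive_increment z0 d3 (fun y => speed _ _ _ _ C0 B0).
  rewrite x0/= !subr0 => n3 n1.
  have {}n1 : `|(x z).1.1| <= r by apply: le_trans n1 _; nra.
  have {}n3 : `|(x z).2| <= r.
    rewrite -[(x z).2](subrK beta) (le_trans (ler_normD _ _))//.
    by rewrite (ger0_norm (_ : 0 <= beta)); [nra|lra].
  have c1 := cos_ge1B_norm (x z).1.1.
  have c3 := cos_ge1B_norm (x z).2.
  (* Both cosines are at least [1 - r], which is positive since [r <= 1 / 4], and
     [(1 - r) ^+ 2 >= 1 - 2 * r]. *)
  have cc : 1 - 2 * r <= cos (x z).2 * cos (x z).1.1 by nra.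
  have ss : `|sin (x z).1.2 * sin (x z).1.1| <= r.
    rewrite normrM -[r]mul1r ler_pM ?sin_max//.
    exact: le_trans (ler_norm_sin _) n1.
  move/ler_normlP: ss => [ss ss'].
  rewrite /f2 (_ : A * B / 2 = B * (A / 2)); last by ring.
  rewrite ler_pM2l// -!mulrA.
  have := ler_wpM2l (ltW A0) cc; have := ler_wpM2l (ltW C0) ss'; lra.
have d11 := abc_second_derivative xsol.
have [||tau tau0 xtau] := convex_dip_root d1 d11 f2ge T0.
- by rewrite x0.
- by rewrite x0.
- by exists tau; split=> //; exists 0; rewrite mul0r.
Qed.

Lemma lebesgue_measure2_rectangle (R : realType) (a b c d : R) :
  a < b -> c < d ->
  lebesgue_measure2 (`[a, b] `*` `[c, d]) = ((b - a) * (d - c))%:E.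
Proof.
move=> ab cd; rewrite /lebesgue_measure2 product_measure1E//=.
by rewrite !lebesgue_measure_itv/= !lte_fin ab cd EFinM.
Qed.

Theorem theorem3p2 (R : realType) (A B C : R)
    (hA : 0 < A) (hB : 0 < B) (hC : 0 < C)
    (Gamma : R -> R -> R -> R * R * R)
    (hGamma : forall alpha beta : R,
       0 <= alpha <= 2 * pi -> 0 <= beta <= 2 * pi ->
       abc_solution A B C (Gamma alpha beta) /\
       Gamma alpha beta 0 = (0, alpha, beta)) :
  exists S : set (measurableTypeR R * measurableTypeR R),
    [/\ measurable S,
        S `<=` `[0, 2 * pi] `*` `[0, 2 * pi],
        (0 < lebesgue_measure2 S)%E
      & forall alpha beta : R, S (alpha, beta) ->
          returns_to_section (Gamma alpha beta)].
Proof.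
pose r := Num.min (1 / 4) (A / 2 / (2 * A + C)).
have r0 : 0 < r by rewrite lt_min !divr_gt0// ?addr_gt0 ?mulr_gt0.
have r4 : r <= 1 / 4 by rewrite ge_min lexx.
have rA : (2 * A + C) * r <= A / 2.
  rewrite mulrC -ler_pdivlMr ?addr_gt0 ?mulr_gt0//.
  by rewrite ge_min lexx orbT.
have V0 : 0 < A + B + C by rewrite !addr_gt0.
have [T T0 Tr] : exists2 T, 0 < T & (A + B + C) * T <= r / 2.
  exists (r / 2 / (A + B + C)); first by rewrite !divr_gt0.
  by rewrite mulrC divfK// gt_eqF.
(* The largest initial speed towards negative [x1] that convexity can undo by time [T]. *)
pose m := A * B / 2 * T / 2.
have m0 : 0 < m by rewrite divr_gt0 ?mulr_gt0 ?divr_gt0 ?mulr_gt0.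
(* For [alpha = pi / 2 + s] the initial velocity of [x1] is [A * sin beta - C * sin s]. Taking
   [s <= a] keeps it above [- m], and the cap 1 keeps [s] where sine increases. *)
pose a := Num.min 1 (m / C).
have a0 : 0 < a by rewrite lt_min ltr01 divr_gt0.
have a1 : a <= 1 by rewrite ge_min lexx.
have am : C * a <= m by rewrite mulrC -ler_pdivlMr// ge_min lexx orbT.
have pi2 := pi_ge2 R.
pose sigma := sin (a / 2).
have sigma0 : 0 < sigma by rewrite sin_gt0_pihalf//; apply/andP; split; lra.
(* Since [sin s >= sigma] for [a / 2 <= s <= a], this makes the [beta] term at most half of
   [C * sin s], so the initial velocity stays negative. *)
pose b := Num.min (r / 2) (C * sigma / (2 * A)).
have b0 : 0 < b by rewrite lt_min !divr_gt0// mulr_gt0.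
have br : b <= r / 2 by rewrite ge_min lexx.
have bA : A * b <= C * sigma / 2.
  have : b <= C * sigma / (2 * A) by rewrite ge_min lexx orbT.
  rewrite ler_pdivlMr ?mulr_gt0// => ?; lra.
(* Starting at [a / 2] rather than 0 keeps [alpha] away from the tangency, so that one [b] serves
   all of these [alpha]. *)
exists (`[a / 2 + pi / 2, a + pi / 2] `*` `[0, b]); split.
- exact: measurableX.
- move=> [u v] [/=]; rewrite !in_itv/= => /andP[? ?] /andP[? ?].
  by split; apply/andP; split; lra.
- rewrite lebesgue_measure2_rectangle; [|lra|lra].
  by rewrite lte_fin mulr_gt0//; lra.
move=> alpha beta [/=]; rewrite !in_itv/= => /andP[al1 al2] /andP[be1 be2].
have [||xsol x0] := hGamma alpha beta; [by apply/andP; split; lra..|].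
apply: (@abc_fold_returns R A B C r T alpha beta) => //; first by rewrite be1/=; lra.
rewrite -(subrK (pi / 2) alpha) cosDpihalf.
set s := alpha - pi / 2.
have as_ : a / 2 <= s by rewrite /s; lra.
have sa : s <= a by rewrite /s; lra.
have s1 : sin s <= s.
  have := ler_norm_sin s; rewrite (ger0_norm (_ : 0 <= s)); last by lra.
  by rewrite ler_norml => /andP[].
have s2 : sigma <= sin s.
  by rewrite leNgt ltr_sin -?leNgt// in_itv/=; apply/andP; split; lra.
have b1 : 0 <= sin beta by rewrite sin_ge0_pi//; apply/andP; split; lra.
have b2 : sin beta <= beta.
  by have := ler_norm_sin beta; rewrite (ger0_norm be1) ler_norml => /andP[].
apply/andP; split.
  rewrite -/m.
  have := mulr_ge0 (ltW hA) b1.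
  have := ler_wpM2l (ltW hC) (le_trans s1 sa).
  by lra.
have := ler_wpM2l (ltW hA) (le_trans b2 be2).
have := ler_wpM2l (ltW hC) s2.
have := mulr_gt0 hC sigma0.
by lra.
Qed.
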